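(* Let $n\ge 1$, let $1\le m\le n$ be an integer, let $E\subset\mathbb{R}^{n+1}$ be a closed set and let $s\in(0,1/3)$ be fixed. Let $\mathcal{T}_m(E)\subset E$ be the set of all points $x\in E$ such that (1) there exists an $s$-approximate tangent $m$-plane $V_x$ for $E$ at $x$, and (2) $E$ satisfies the weak lower Ahlfors-David $m$-regularity condition at $x$. Then there exists a countable collection of bounded Lipschitz graphs $\{\Gamma_j\}_{j\ge 1}$ such that $\mathcal{T}_m(E)\subset\bigcup_{j\ge 1}\Gamma_j$. In particular, $\mathcal{T}_m(E)$ is $m$-rectifiable.
   Context: It is not assumed that $\mathcal{H}^m|_E$ is locally finite. Notation: $B(x,r)$ is the open ball in $\mathbb{R}^d$; $\mathcal{H}^m$ is $m$-dimensional Hausdorff measure; $G(d,m)$ is the set of $m$-dimensional linear subspaces of $\mathbb{R}^d$. Here $d=n+1$. Weak lower Ahlfors-David $m$-regularity (WLADR) at $x$: a set $E\subset\mathbb{R}^d$ satisfies it at $x\in E$ if there is $\rho_x>0$ such that $$\inf\left\{\frac{\mathcal{H}^m(B(y,r)\cap E)}{r^m}: y\in B(x,\rho_x)\cap E,\ 0<r<\rho_x\right\}>0.$$ Cones: for $V\in G(d,m)$, $\xi\in\mathbb{R}^d$, $s\in(0,1)$, $X(\xi,V,s)=\{x\in\mathbb{R}^d:\operatorname{dist}(x-\xi,V)<s|x-\xi|\}$. $s$-approximate tangent: for fixed $s\in(0,1)$, $V\in G(d,m)$ is an $s$-approximate tangent $m$-plane for $E$ at $\xi$ if $\limsup_{r\to0}\mathcal{H}^m(E\cap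 B(\xi,r))/r^m>0$ and $\lim_{r\to 0} r^{-m}\mathcal{H}^m\big(E\cap B(\xi,r)\setminus X(\xi,V,s)\big)=0$. A Lipschitz graph ($m$-dimensional) is, up to a rigid motion of $\mathbb{R}^{n+1}$, a set $\{(y,\psi(y)):y\in A\}$ with $A\subset\mathbb{R}^m$ and $\psi:A\to\mathbb{R}^{n+1-m}$ Lipschitz; it is bounded if it is a bounded set. A set $A\subset\mathbb{R}^d$ is $m$-rectifiable if $\mathcal{H}^m(A\setminus\bigcup_{i\ge1}f_i(E_i))=0$ for some sets $E_i\subset\mathbb{R}^m$ and Lipschitz maps $f_i:E_i\to\mathbb{R}^d$. *)

(* Defs.v *)
From HB Require Import structures.
From mathcomp Require Import all_boot all_order all_algebra.
From mathcomp Require Import all_classical all_reals all_analysis.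

Set Implicit Arguments.
Unset Strict Implicit.
Unset Printing Implicit Defensive.

Import Order.TTheory GRing.Theory Num.Theory.
Import numFieldNormedType.Exports.

Local Open Scope classical_set_scope.
Local Open Scope ring_scope.

(* The norm carried by the library's matrix types is the sup norm; metric
   notions below (balls, diameters, distances, Lipschitz constants) use the
   Euclidean norm instead. Closedness and boundedness do not depend on this
   choice and are taken from the library. *)
Definition enorm (R : realType) (d : nat) (x : 'rV[R]_d) : R :=
  Num.sqrt (\sum_(i < d) x ord0 i ^+ 2).

Definition eball (R : realType) (d : nat) (x : 'rV[R]_d) (r : R) :
    set 'rV[R]_d :=
  [set y | enorm (y - x) < r].

(* The element 0 is added so that the empty set has diameter 0, not -oo. *)
Definition ediam (R : realType) (d : nat) (A : set 'rV[R]_d) : \bar R :=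
  ereal_sup (0%:E |` [set (enorm (x - y))%:E | x in A & y in A]).

(* Hausdorff measure without the normalizing constant (for m = 1, ..., d it is
   a fixed positive multiple of the measure normalized to agree with Lebesgue
   measure on m-planes). Meaningful for 0 < m only: empty sets in a cover
   contribute 0 ^+ m. *)
Definition hausdorff_content (R : realType) (d m : nat) (delta : R)
    (A : set 'rV[R]_d) : \bar R :=
  ereal_inf [set (\sum_(0 <= i <oo) ediam (U i) ^+ m)%E |
    U in [set U : nat -> set 'rV[R]_d |
      A `<=` \bigcup_i U i /\ forall i, (ediam (U i) <= delta%:E)%E]].

Definition hausdorff (R : realType) (d m : nat) (A : set 'rV[R]_d) : \bar R :=
  ereal_sup [set hausdorff_content m delta A | delta in [set delta : R | 0 < delta]].

Definition WLADR (R : realType) (d m : nat) (E : set 'rV[R]_d)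
    (x : 'rV[R]_d) : Prop :=
  exists2 rho : R, 0 < rho &
    (0 < ereal_inf [set q : \bar R | exists (y : 'rV[R]_d) (r : R),
      [/\ (eball x rho `&` E) y, (0 < r < rho)%R &
          q = hausdorff m (eball y r `&` E) * ((r ^+ m)^-1)%:E]])%E.

Definition dist_to (R : realType) (d : nat) (V : {vspace 'rV[R]_d})
    (x : 'rV[R]_d) : R :=
  inf [set enorm (x - v) | v in [set v | v \in V]].

Definition cone (R : realType) (d : nat) (xi : 'rV[R]_d)
    (V : {vspace 'rV[R]_d}) (s : R) : set 'rV[R]_d :=
  [set x | dist_to V (x - xi) < s * enorm (x - xi)].

Definition approx_tangent (R : realType) (d m : nat) (s : R)
    (E : set 'rV[R]_d) (xi : 'rV[R]_d) (V : {vspace 'rV[R]_d}) : Prop :=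
  [/\ \dim V = m,
      (0 < limf_esup
        (fun r : R => hausdorff m (E `&` eball xi r) * ((r ^+ m)^-1)%:E)
        0^'+)%E &
      (((r ^+ m)^-1)%:E * hausdorff m ((E `&` eball xi r) `\` cone xi V s))%E
        @[r --> 0^'+] --> 0%E].

Definition tangent_points (R : realType) (d m : nat) (s : R)
    (E : set 'rV[R]_d) : set 'rV[R]_d :=
  [set x | [/\ E x, exists V, approx_tangent m s E x V & WLADR m E x]].

Definition elipschitz (R : realType) (p q : nat) (A : set 'rV[R]_p)
    (f : 'rV[R]_p -> 'rV[R]_q) : Prop :=
  exists L : R, forall x y, A x -> A y ->
    enorm (f x - f y) <= L * enorm (x - y).

(* Row vectors: x |-> x *m Q + b with Q orthogonal (reflections allowed). *)
Definition rigid_motion (R : realType) (d : nat)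
    (g : 'rV[R]_d -> 'rV[R]_d) : Prop :=
  exists (Q : 'M[R]_d) (b : 'rV[R]_d),
    Q *m Q^T = 1%:M /\ forall x, g x = x *m Q + b.

(* The equation e only serves to view (y, psi y) as a point of R^d; functions
   on A are represented by total functions, used on A only. *)
Definition lipschitz_graph (R : realType) (d m : nat)
    (Gamma : set 'rV[R]_d) : Prop :=
  exists (e : (m + (d - m))%N = d) (A : set 'rV[R]_m)
      (psi : 'rV[R]_m -> 'rV[R]_(d - m)) (g : 'rV[R]_d -> 'rV[R]_d),
    [/\ elipschitz A psi, rigid_motion g &
        Gamma = g @` [set castmx (erefl, e) (row_mx y (psi y)) | y in A]].

Definition rectifiable (R : realType) (d m : nat) (A : set 'rV[R]_d) : Prop :=
  exists (D : nat -> set 'rV[R]_m) (f : nat -> 'rV[R]_m -> 'rV[R]_d),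
    (forall i, elipschitz (D i) (f i)) /\
    hausdorff m (A `\` \bigcup_i (f i @` D i)) = 0%E.

(* Main.v *)
Require Import Defs.
From mathcomp Require Import all_boot all_order all_algebra.
From mathcomp Require Import all_classical all_reals all_analysis.
From mathcomp Require Import ring lra.
Import Order.TTheory GRing.Theory Num.Theory.
Import numFieldNormedType.Exports.
Local Open Scope classical_set_scope.
Local Open Scope ring_scope.

Set Implicit Arguments.
Unset Strict Implicit.
Unset Printing Implicit Defensive.

(** The properties of Hausdorff measure behind the result are its monotonicity
    and, for rectifiability, its vanishing on the empty set. Let [x] be a tangent
    point, with plane [V] and aperture [s], and let [s < s' < 1]. If a point [y]
    of [E] at distance [t] from [x] were outside the cone of aperture [s'] around
    [V], then a ball about [y] of radius proportional to [t] would be outside the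
    cone of aperture [s], and lower regularity would put a measure comparable to
    [t ^+ m] there; for small [t] this contradicts the approximate tangency. So
    near [x] the set [E] genuinely lies in the wider cone
    ([tangent_cone_containment]).

    An orthogonal matrix [Q] takes [V] to the span of the first [m] coordinates
    ([orthogonal_flatten]), and the cone condition at [x] then says that the last
    [d - m] coordinates of [(y - x) *m Q] are bounded by [s' * |y - x|] for all
    [y] in [E] with [|y - x| < r] ([tangent_flat]). Both [Q] and [r] depend on
    [x], but orthogonal matrices and points can be approximated by rational ones,
    so the tangent points split into countably many pieces, each of diameter less
    than the radii [r] of its points, on each of which a single [Q] serves all
    points, with a constant slightly larger than [s'] and still below [1]
    ([countable_graph_cover]). On such a piece the first [m] coordinates
    dominate every chord, which makes the piece a Lipschitz graph
    ([lipschitz_graph_of_chords]). *)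

(** * The Euclidean norm *)

Lemma enorm_ge0 (R : realType) d (x : 'rV[R]_d) : 0 <= enorm x.
Proof. exact: sqrtr_ge0. Qed.

Lemma enorm_sqr (R : realType) d (x : 'rV[R]_d) :
  enorm x ^+ 2 = \sum_(i < d) x ord0 i ^+ 2.
Proof. by rewrite sqr_sqrtr// sumr_ge0// => i _; exact: sqr_ge0. Qed.

Lemma enorm_sqr_mx (R : realType) d (x : 'rV[R]_d) :
  enorm x ^+ 2 = (x *m x^T) ord0 ord0.
Proof.
by rewrite enorm_sqr mxE; apply: eq_bigr => i _; rewrite !mxE expr2.
Qed.

Lemma enormN (R : realType) d (x : 'rV[R]_d) : enorm (- x) = enorm x.
Proof.
by rewrite /enorm; congr Num.sqrt; apply: eq_bigr => i _; rewrite mxE sqrrN.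
Qed.

Lemma enormB (R : realType) d (x y : 'rV[R]_d) : enorm (x - y) = enorm (y - x).
Proof. by rewrite -enormN opprB. Qed.

Lemma enorm0 (R : realType) d : enorm (0 : 'rV[R]_d) = 0.
Proof.
rewrite /enorm big1 ?sqrtr0// => i _; by rewrite mxE expr0n.
Qed.

Lemma entry_le_enorm (R : realType) d (x : 'rV[R]_d) i :
  `|x ord0 i| <= enorm x.
Proof.
rewrite -(@ler_pXn2r _ 2) ?nnegrE ?enorm_ge0// enorm_sqr real_normK ?num_real//.
by rewrite (bigD1 i)//= lerDl sumr_ge0// => j _; exact: sqr_ge0.
Qed.

Lemma enorm_eq0 (R : realType) d (x : 'rV[R]_d) : enorm x = 0 -> x = 0.
Proof.
move=> x0; apply/rowP => i; rewrite mxE; apply/eqP.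
by rewrite -normr_le0 -x0; exact: entry_le_enorm.
Qed.

(** Weighting the inequality [2 x_i y_i <= c x_i^2 + c^-1 y_i^2] with
    [c = |y| / |x|] makes the right-hand sides add up to [2 * |x| * |y|]. *)
Lemma cauchy_schwarz (R : realType) d (x y : 'rV[R]_d) :
  \sum_(i < d) x ord0 i * y ord0 i <= enorm x * enorm y.
Proof.
have [x0|x0] := eqVneq (enorm x) 0.
  rewrite x0 mul0r big1// => i _; by rewrite (enorm_eq0 x0) mxE mul0r.
have [y0|y0] := eqVneq (enorm y) 0.
  rewrite y0 mulr0 big1// => i _; by rewrite (enorm_eq0 y0) mxE mulr0.
have xp : 0 < enorm x by rewrite lt_neqAle eq_sym x0 enorm_ge0.
have yp : 0 < enorm y by rewrite lt_neqAle eq_sym y0 enorm_ge0.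
set c := enorm y / enorm x.
have c0 : 0 < c by rewrite divr_gt0.
have -> : enorm x * enorm y =
    \sum_(i < d) (c * x ord0 i ^+ 2 + c^-1 * y ord0 i ^+ 2) / 2.
  rewrite -mulr_suml big_split/= -!mulr_sumr -!enorm_sqr /c.
  by field; rewrite x0 y0.
apply: ler_sum => i _; set a := x _ _; set b := y _ _.
rewrite -subr_ge0.
have -> : (c * a ^+ 2 + c^-1 * b ^+ 2) / 2 - a * b = (c * a - b) ^+ 2 / (2 * c).
  by field; rewrite gt_eqF.
by rewrite divr_ge0 ?sqr_ge0// mulr_ge0// ltW.
Qed.

Lemma ler_enormD (R : realType) d (x y : 'rV[R]_d) :
  enorm (x + y) <= enorm x + enorm y.
Proof.
rewrite -(@ler_pXn2r _ 2) ?nnegrE ?addr_ge0 ?enorm_ge0//.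
have -> : enorm (x + y) ^+ 2 =
    enorm x ^+ 2 + enorm y ^+ 2 + (\sum_(i < d) x ord0 i * y ord0 i) *+ 2.
  rewrite !enorm_sqr -sumrMnl -!big_split/=; apply: eq_bigr => i _.
  by rewrite mxE sqrrD addrAC.
by rewrite sqrrD [leRHS]addrAC lerD2l lerMn2r cauchy_schwarz.
Qed.

Lemma enorm_le_sum (R : realType) d (x : 'rV[R]_d) :
  enorm x <= \sum_(i < d) `|x ord0 i|.
Proof.
have s0 : 0 <= \sum_(i < d) `|x ord0 i| by rewrite sumr_ge0.
rewrite -(@ler_pXn2r _ 2) ?nnegrE ?enorm_ge0// enorm_sqr expr2 mulr_suml.
apply: ler_sum => i _; rewrite -real_normK ?num_real// expr2 ler_wpM2l//.
by rewrite (bigD1 i)//= lerDl sumr_ge0.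
Qed.

Lemma enorm_le_entries (R : realType) d (e : R) (x : 'rV[R]_d) :
  (forall i, `|x ord0 i| <= e) -> enorm x <= d%:R * e.
Proof.
move=> xe; apply: (le_trans (enorm_le_sum _)).
rewrite mulr_natl -[X in _ *+ X]card_ord -sumr_const.
by apply: ler_sum => i _; exact: xe.
Qed.

Lemma enorm_mulmx_le (R : realType) p q (e : R) (M : 'M[R]_(p, q)) (u : 'rV_p) :
  (forall i j, `|M i j| <= e) -> enorm (u *m M) <= q%:R * (p%:R * e) * enorm u.
Proof.
move=> Me; rewrite -mulrA; apply: enorm_le_entries => j; rewrite mxE.
apply: (le_trans (ler_norm_sum _ _ _)).
rewrite -mulrA mulr_natl -[X in _ *+ X]card_ord -sumr_const.
apply: ler_sum => i _; rewrite normrM mulrC.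
by rewrite ler_pM// entry_le_enorm.
Qed.

Lemma enorm_orthogonal (R : realType) d (Q : 'M[R]_d) (u : 'rV_d) :
  Q *m Q^T = 1%:M -> enorm (u *m Q) = enorm u.
Proof.
move=> QQ; apply/eqP; rewrite -(@eqrXn2 _ 2) ?enorm_ge0//.
by rewrite !enorm_sqr_mx trmx_mul mulmxA -(mulmxA u) QQ mulmx1.
Qed.

Lemma enorm_row_mx (R : realType) p q (u : 'rV[R]_p) (v : 'rV[R]_q) :
  enorm (row_mx u v) ^+ 2 = enorm u ^+ 2 + enorm v ^+ 2.
Proof.
rewrite !enorm_sqr big_split_ord/=.
by congr +%R; apply: eq_bigr => i _; rewrite (row_mxEl, row_mxEr).
Qed.

Lemma enorm_row_mx_le (R : realType) p q (u : 'rV[R]_p) (v : 'rV[R]_q) :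
  enorm (row_mx u v) <= enorm u + enorm v.
Proof.
rewrite -(@ler_pXn2r _ 2) ?nnegrE ?addr_ge0 ?enorm_ge0// enorm_row_mx sqrrD.
by rewrite addrAC lerDl mulrn_wge0// mulr_ge0 ?enorm_ge0.
Qed.

Lemma enorm_castmx (R : realType) p q (e : p = q) (u : 'rV[R]_p) :
  enorm (castmx (erefl, e) u) = enorm u.
Proof. by case: q / e. Qed.

(** * Orthogonal changes of coordinates *)

(** The Householder reflection in the hyperplane orthogonal to [a - b]
    exchanges [a] and [b]. *)
Lemma orthogonal_map (R : realType) d (a b : 'rV[R]_d) : enorm a = enorm b ->
  exists2 H : 'M[R]_d, H *m H^T = 1%:M & a *m H = b.
Proof.
move=> ab.
have [w bw] : exists w, b = a - w by exists (a - b); rewrite opprB addrC subrK.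
have [w0|w0] := eqVneq w 0.
  exists 1%:M; first by rewrite trmx1 mulmx1.
  by rewrite mulmx1 bw w0 subr0.
set q := enorm w ^+ 2.
have q0 : q != 0.
  by rewrite sqrf_eq0; apply: contra_neq w0 => /enorm_eq0.
have ww : w *m w^T = q%:M by rewrite [LHS]mx11_scalar /q enorm_sqr_mx.
have aw : a *m w^T = (q / 2)%:M.
  rewrite [LHS]mx11_scalar; congr (_%:M).
  have bE : enorm b ^+ 2 = q - 2 * (a *m w^T) ord0 ord0 + enorm a ^+ 2.
    rewrite bw /q !enorm_sqr_mx !mxE mulr_sumr -!sumrN -!big_split/=.
    by apply: eq_bigr => i _; rewrite !mxE; ring.
  by move: bE; rewrite ab => bE; lra.
pose P := w^T *m w.
have PP : P *m P = q *: P.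
  by rewrite /P mulmxA -(mulmxA w^T) ww mul_mx_scalar scalemxAl.
have HT : (1%:M - (2 / q) *: P)^T = 1%:M - (2 / q) *: P.
  by apply/matrixP => i j; rewrite !mxE eq_sym; congr (_ - _ * _);
    apply: eq_bigr => k _; rewrite !mxE mulrC.
exists (1%:M - (2 / q) *: P).
  rewrite HT mulmxBl !mulmxBr !mul1mx mulmx1 -scalemxAl -scalemxAr PP !scalerA.
  have -> : 2 / q * (2 / q) * q = 2 / q + 2 / q by field.
  by rewrite scalerDl opprB addrK subrK.
rewrite mulmxBr mulmx1 -scalemxAr mulmxA aw mul_scalar_mx scalerA.
have -> : 2 / q * (q / 2) = 1 by field.
by rewrite scale1r -bw.
Qed.

(** Reflect the first row onto the first coordinate axis, then treat the
    remaining rows in the remaining coordinates. *)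
Lemma orthogonal_triangular (R : realType) m d (A : 'M[R]_(m, d)) :
  exists2 Q : 'M[R]_d, Q *m Q^T = 1%:M &
    forall i (j : 'I_d), (m <= j)%N -> (A *m Q) i j = 0.
Proof.
elim: m d A => [|m IH] [|d] A.
- by exists 1%:M; [rewrite trmx1 mulmx1|case].
- by exists 1%:M; [rewrite trmx1 mulmx1|case].
- by exists 1%:M; [rewrite trmx1 mulmx1|move=> i []].
pose a : 'rV[R]_(1 + d) := usubmx (A : 'M[R]_(1 + m, 1 + d)).
pose b : 'rV[R]_(1 + d) := row_mx (enorm a)%:M 0.
have [H HH aH] : exists2 H : 'M[R]_(1 + d), H *m H^T = 1%:M & a *m H = b.
  apply: orthogonal_map; apply/eqP; rewrite -(@eqrXn2 _ 2) ?enorm_ge0//.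
  by rewrite enorm_row_mx enorm0 expr0n addr0 (enorm_sqr (_%:M)) big_ord1 mxE.
pose B : 'M[R]_(1 + m, 1 + d) := A *m H.
have urB : ursubmx B = 0.
  by rewrite /ursubmx /B -mul_usub_mx aH row_mxKr.
have [Q QQ BQ] := IH _ (drsubmx B).
pose K : 'M[R]_(1 + d) := block_mx 1%:M 0 0 Q.
have KK : K *m K^T = 1%:M.
  rewrite /K tr_block_mx mulmx_block trmx1 !trmx0 !mulmx0 !mul0mx mulmx1.
  by rewrite !add0r !addr0 QQ -scalar_mx_block.
exists (H *m K); first by rewrite trmx_mul mulmxA -(mulmxA H K) KK mulmx1.
have BK : B *m K = block_mx (ulsubmx B) 0 (dlsubmx B) (drsubmx B *m Q).
  rewrite -[B in LHS]submxK urB /K mulmx_block.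
  by rewrite !mulmx0 !mulmx1 !mul0mx !addr0 !add0r.
move=> i j mj; rewrite mulmxA [A *m H *m K]BK.
case: (split_ordP (j : 'I_(1 + d))) mj => j' ->; first by case: j' => -[].
rewrite /= ltnS => mj.
case: (split_ordP (i : 'I_(1 + m))) => i' ->.
  by apply: etrans (block_mxEur _ _ _ _ i' j') _; rewrite mxE.
by apply: etrans (block_mxEdr _ _ _ _ i' j') _; exact: BQ.
Qed.

(** Triangularise the matrix whose rows are a basis of [V]. *)
Lemma orthogonal_flatten (R : realType) d (V : {vspace 'rV[R]_d}) :
  exists2 Q : 'M[R]_d, Q *m Q^T = 1%:M &
    forall v (j : 'I_d), v \in V -> (\dim V <= j)%N -> (v *m Q) ord0 j = 0.
Proof.
have [Q QQ VQ] := orthogonal_triangular (\matrix_(i < \dim V) (vbasis V)`_i).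
exists Q => // v j /coord_vbasis -> Vj.
rewrite mulmx_suml summxE big1// => i _.
rewrite -scalemxAl mxE -[X in X *m Q](rowK (fun k : 'I_(\dim V) => (vbasis V)`_k)).
by rewrite -row_mul mxE VQ// mulr0.
Qed.

Definition head_mx (R : realType) m k d (e : (m + k)%N = d) (u : 'rV[R]_d) :
    'rV_m :=
  lsubmx (castmx (erefl, esym e) u).

Definition tail_mx (R : realType) m k d (e : (m + k)%N = d) (u : 'rV[R]_d) :
    'rV_k :=
  rsubmx (castmx (erefl, esym e) u).

Section HeadTail.
Variables (R : realType) (m k d : nat) (e : (m + k)%N = d).
Implicit Types u v : 'rV[R]_d.

Lemma row_head_tail u :
  castmx (erefl, e) (row_mx (head_mx e u) (tail_mx e u)) = u.
Proof. by rewrite /head_mx /tail_mx hsubmxK castmxKV. Qed.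

Lemma castmx_row_mxB (a a' : 'rV[R]_m) (b b' : 'rV[R]_k) :
  castmx (erefl, e) (row_mx a b) - castmx (erefl, e) (row_mx a' b') =
  castmx (erefl, e) (row_mx (a - a') (b - b')).
Proof. by case: d / e; rewrite !castmx_id opp_row_mx add_row_mx. Qed.

Lemma head_mxB u v : head_mx e (u - v) = head_mx e u - head_mx e v.
Proof. by apply/rowP => j; rewrite !(castmxE, mxE). Qed.

Lemma tail_mxB u v : tail_mx e (u - v) = tail_mx e u - tail_mx e v.
Proof. by apply/rowP => j; rewrite !(castmxE, mxE). Qed.

Lemma tail_mxD u v : tail_mx e (u + v) = tail_mx e u + tail_mx e v.
Proof. by apply/rowP => j; rewrite !(castmxE, mxE). Qed.

Lemma tail_mx_eq0 u : (forall j : 'I_d, (m <= j)%N -> u ord0 j = 0) ->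
  tail_mx e u = 0.
Proof.
by move=> u0; apply/rowP => j; rewrite !(castmxE, mxE)/= cast_ord_id u0//= leq_addr.
Qed.

Lemma enorm_head_tail u :
  enorm u ^+ 2 = enorm (head_mx e u) ^+ 2 + enorm (tail_mx e u) ^+ 2.
Proof. by rewrite -{1}(row_head_tail u) enorm_castmx enorm_row_mx. Qed.

Lemma enorm_tail_le u : enorm (tail_mx e u) <= enorm u.
Proof.
by rewrite -(@ler_pXn2r _ 2) ?nnegrE ?enorm_ge0// enorm_head_tail lerDr sqr_ge0.
Qed.

Lemma enorm_le_head_tail u :
  enorm u <= enorm (head_mx e u) + enorm (tail_mx e u).
Proof. by rewrite -{1}(row_head_tail u) enorm_castmx enorm_row_mx_le. Qed.

End HeadTail.

(** * Lipschitz graphs *)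

(** In coordinates where [d - m] of the components of every chord are bounded
    by [t < 1] times its length, the first [m] components control the chord, so
    they determine the point and the remaining ones are a Lipschitz function
    of them. *)
Lemma lipschitz_graph_of_chords (R : realType) d m (e : (m + (d - m))%N = d)
    (S : set 'rV[R]_d) (Q : 'M[R]_d) (t : R) : Q *m Q^T = 1%:M -> 0 <= t -> t < 1 ->
  (forall x y, S x -> S y ->
    enorm (tail_mx e ((x - y) *m Q)) <= t * enorm (x - y)) ->
  lipschitz_graph m S.
Proof.
move=> QQ t0 t1 St.
pose h x := head_mx e (x *m Q); pose l x := tail_mx e (x *m Q).
have lip x y : S x -> S y ->
    enorm (l x - l y) <= t / (1 - t) * enorm (h x - h y).
  move=> Sx Sy; rewrite -tail_mxB -head_mxB -mulmxBl.
  have := St _ _ Sx Sy; have := enorm_le_head_tail e ((x - y) *m Q).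
  rewrite (enorm_orthogonal _ QQ).
  set a := enorm (x - y); set b := enorm (head_mx _ _); set c := enorm _.
  move=> abc cta.
  rewrite mulrAC ler_pdivlMr ?subr_gt0//.
  by have := ler_wpM2l t0 abc; lra.
have inj x y : S x -> S y -> h x = h y -> l x = l y.
  move=> Sx Sy hxy; apply/eqP; rewrite -subr_eq0; apply/eqP/enorm_eq0/le_anti.
  by rewrite enorm_ge0 andbT (le_trans (lip _ _ Sx Sy))// hxy subrr enorm0 mulr0.
(* [l] factors through [h] on [S], so any preimage of [y] in [S] under [h]
   may be used *)
pose psi y := l (xget 0 [set x | S x /\ h x = y]).
have psih x : S x -> psi (h x) = l x.
  move=> Sx; have [] := @xgetPex _ 0 [set z | S z /\ h z = h x] (ex_intro _ x (conj Sx erefl)).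
  by move=> Sz hz; exact: inj.
have QTQ : Q^T *m Q = 1%:M by exact: mulmx1C.
exists e, (h @` S), psi, (fun x => x *m Q^T + 0); split.
- exists (t / (1 - t)) => _ _ [x Sx <-] [y Sy <-].
  by rewrite !psih//; exact: lip.
- by exists Q^T, 0; rewrite trmxK.
- have back x : S x -> castmx (erefl, e) (row_mx (h x) (psi (h x))) *m Q^T + 0 = x.
    by move=> Sx; rewrite psih// row_head_tail -mulmxA QQ mulmx1 addr0.
  apply/seteqP; split => x.
  + by move=> Sx; exists (castmx (erefl, e) (row_mx (h x) (psi (h x))));
      [exists (h x); [exists x|]|exact: back].
  + by move=> [_ [_ [z Sz <-] <-] <-]; rewrite back.
Qed.

(** The rigid motion is an isometry, so only the graph map
    [y |-> (y, psi y)] contributes to the Lipschitz constant. *)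
Lemma lipschitz_graph_param (R : realType) d m (Gamma : set 'rV[R]_d) :
  lipschitz_graph m Gamma -> exists (D : set 'rV[R]_m) (f : 'rV[R]_m -> 'rV[R]_d),
    elipschitz D f /\ Gamma = f @` D.
Proof.
move=> [e [A [psi [g [[L psiL] [Q [b [QQ gE]]] ->]]]]].
exists A, (fun y => g (castmx (erefl, e) (row_mx y (psi y)))); split; last first.
  by rewrite image_comp.
exists (1 + L) => x y Ax Ay.
rewrite !gE opprD addrACA subrr addr0 -mulmxBl enorm_orthogonal//.
rewrite castmx_row_mxB.
rewrite enorm_castmx (le_trans (enorm_row_mx_le _ _))// mulrDl mul1r lerD2l.
exact: psiL.
Qed.

(** * Approximate tangents of lower regular sets *)

Lemma le_hausdorff (R : realType) d m (A B : set 'rV[R]_d) :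
  A `<=` B -> (hausdorff m A <= hausdorff m B)%E.
Proof.
move=> AB; apply: ge_ereal_sup => _ [delta delta0 <-].
apply: le_trans (ereal_sup_ubound _); last by exists delta.
apply: ereal_inf_le_tmp => _ [U [BU Ud] <-]; exists U => //.
by split => //; exact: subset_trans BU.
Qed.

Lemma ediam_ge0 (R : realType) d (A : set 'rV[R]_d) : (0 <= ediam A)%E.
Proof. by apply: ereal_sup_ubound; left. Qed.

Lemma ediam0 (R : realType) d : ediam (set0 : set 'rV[R]_d) = 0%E.
Proof.
apply/le_anti; rewrite ediam_ge0 andbT.
by apply: ge_ereal_sup => q [->|[x []]].
Qed.

Lemma hausdorff0 (R : realType) d m : (0 < m)%N ->
  hausdorff m (set0 : set 'rV[R]_d) = 0%E.
Proof.
move=> m0; apply/le_anti/andP; split.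
  apply: ge_ereal_sup => _ [delta /= delta0 <-].
  apply: ereal_inf_lbound; exists (fun=> set0).
    by split => // i; rewrite ediam0 lee_fin ltW.
  by apply: eseries0 => i _ _; apply/eqP; rewrite expe_eq0 m0 ediam0 eqxx.
apply: le_ereal_sup_tmp; exists (hausdorff_content m 1 (set0 : set 'rV[R]_d)).
  by exists 1 => /=.
apply: le_ereal_inf_tmp => _ [U _ <-]; apply: nneseries_ge0 => i _ _.
by rewrite expe_ge0// ediam_ge0.
Qed.

Lemma dist_to_le (R : realType) d (V : {vspace 'rV[R]_d}) (u v : 'rV[R]_d) :
  dist_to V u <= dist_to V v + enorm (u - v).
Proof.
rewrite -lerBlDr; apply: lb_le_inf; first by exists (enorm (v - 0)), 0 => //=; exact: mem0v.
move=> _ [w Vw <-]; rewrite lerBlDr.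
apply: le_trans (_ : enorm (u - w) <= _).
  apply: ge_inf; last by exists w.
  by exists 0 => _ [z _ <-]; exact: enorm_ge0.
by rewrite -(subrK v u) -addrA addrC (le_trans (ler_enormD _ _))// subrK.
Qed.

(** If [y] in [E], at distance [t] from [x], lies outside the cone of aperture
    [s'], then for [s < s'] and a suitable [eta] the whole ball of radius
    [eta * t] about [y] lies outside the cone of aperture [s]. By lower
    regularity that ball carries a definite multiple of [t ^+ m] of the measure
    of [E], which for small [t] contradicts the vanishing of the density of [E]
    outside the smaller cone. *)
Lemma tangent_cone_containment (R : realType) d m (s s' : R)
    (E : set 'rV[R]_d) (x : 'rV[R]_d) (V : {vspace 'rV[R]_d}) :
  0 < s -> s < s' -> s' <= 1 -> approx_tangent m s E x V -> WLADR m E x ->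
  exists2 r : R, 0 < r &
    forall y, E y -> 0 < enorm (y - x) < r -> cone x V s' y.
Proof.
move=> s0 ss' s'1 [_ _ tan] [rho rho0 reg].
have [c c0 cle] : exists2 c : R, 0 < c & forall y r, E y ->
    enorm (y - x) < rho -> 0 < r < rho ->
    ((c * r ^+ m)%:E <= hausdorff m (eball y r `&` E))%E.
  (* the infimum may be infinite, so a finite lower bound is extracted *)
  have [c c0 cinf] : exists2 c : R, 0 < c & (c%:E <= ereal_inf [set q : \bar R |
      exists (y : 'rV[R]_d) (r : R), [/\ (eball x rho `&` E) y, (0 < r < rho)%R &
          q = hausdorff m (eball y r `&` E) * ((r ^+ m)^-1)%:E]])%E.
    move: reg; case: ereal_inf => [c c0|_|//]; first by exists c.
    by exists 1; rewrite ?leey.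
  exists c => // y r Ey yx /andP[r0 rr].
  rewrite EFinM -lee_pdivlMr ?exprn_gt0//; apply: le_trans cinf _.
  by apply: ereal_inf_lbound; exists y, r; split => //; rewrite r0.
(* this choice gives [s' - eta >= s * (1 + eta)] *)
pose eta := (s' - s) / 2.
have eta0 : 0 < eta by rewrite divr_gt0 ?subr_gt0.
have eta1 : eta <= 1 by rewrite ler_pdivrMr//; lra.
have small : 0 < c * (eta / 2) ^+ m by rewrite mulr_gt0// exprn_gt0// divr_gt0.
have : \forall r \near 0^'+, (((r ^+ m)^-1)%:E *
    hausdorff m ((E `&` eball x r) `\` cone x V s) < (c * (eta / 2) ^+ m)%:E)%E.
  apply: (tan [set q | (q < (c * (eta / 2) ^+ m)%:E)%E]).
  apply: open_nbhs_nbhs; split; first exact: open_ereal_lt_ereal.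
  by rewrite /= lte_fin.
move=> [/= del /= del0 near_del].
exists (Num.min rho (del / 2)); first by rewrite lt_min rho0 divr_gt0.
move=> y Ey; set t := enorm (y - x).
rewrite lt_min => /and3P[t0 trho tdel]; apply: contrapT => /negP.
rewrite -leNgt -/t => ty.
(* the ball of radius [eta * t] about [y] lies in the ball of radius [2 * t]
   about [x] *)
have := near_del (2 * t).
rewrite /ball_/= sub0r normrN gtr0_norm ?mulr_gt0// => /(_ ltac:(lra) ltac:(lra)).
rewrite lte_pdivrMl ?exprn_gt0 ?mulr_gt0//.
apply/negP; rewrite -leNgt.
rewrite -EFinM.
have -> : (2 * t) ^+ m * (c * (eta / 2) ^+ m) = c * (eta * t) ^+ m.
  rewrite mulrCA -exprMn; congr (_ * _ ^+ _); by field.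
apply: le_trans (cle y (eta * t) Ey trho _) _.
  rewrite mulr_gt0//= (le_lt_trans _ trho)// ler_piMl// ltW//.
apply: le_hausdorff => z [zy Ez].
have zx : enorm (z - x) < eta * t + t.
  by rewrite -(subrK y z) -addrA (le_lt_trans (ler_enormD _ _))// ltrD2r.
split; first split => //.
  by apply: lt_le_trans zx _; have := ler_wpM2r (ltW t0) eta1; lra.
apply/negP; rewrite -leNgt.
have := dist_to_le V (y - x) (z - x).
rewrite (_ : y - x - (z - x) = y - z); last by rewrite opprB addrA subrK.
rewrite (enormB y z) => yz.
have etat : 2 * (eta * t) = s' * t - s * t by rewrite /eta; field.
have seta : s * (eta * t) <= eta * t by rewrite ler_piMl ?mulr_ge0//; lra.
have := ler_wpM2l (ltW s0) (ltW zx); rewrite mulrDr.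
have {}zy : enorm (z - y) < eta * t := zy.
lra.
Qed.

(** The cone condition at [x] up to the scale [r], for the plane that [Q] takes
    to the span of the first [m] coordinates. *)
Definition flat_at (R : realType) m k d (e : (m + k)%N = d) (S : set 'rV[R]_d)
    (r t : R) (Q : 'M[R]_d) (x : 'rV[R]_d) : Prop :=
  forall y, S y -> enorm (y - x) < r ->
    enorm (tail_mx e ((y - x) *m Q)) <= t * enorm (y - x).

(** Subtracting from [y - x] a nearby vector of [V] does not change the last
    coordinates after applying [Q]. *)
Lemma tangent_flat (R : realType) d m k (e : (m + k)%N = d) (s s' : R)
    (E : set 'rV[R]_d) (x : 'rV[R]_d) :
  0 < s -> s < s' -> s' <= 1 -> tangent_points m s E x ->
  exists (Q : 'M[R]_d) (r : R),
    [/\ Q *m Q^T = 1%:M, 0 < r & flat_at e E r s' Q x].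
Proof.
move=> s0 ss' s'1 [_ [V tan] reg].
have [r r0 con] := tangent_cone_containment s0 ss' s'1 tan reg.
have [Q QQ VQ] := orthogonal_flatten V.
have [dimV _ _] := tan; rewrite dimV in VQ.
exists Q, r; split => // y Ey yr.
have [yx|yx] := eqVneq (enorm (y - x)) 0.
  by rewrite (le_trans (enorm_tail_le _ _))// enorm_orthogonal// yx mulr0.
have yx0 : 0 < enorm (y - x) by rewrite lt_neqAle eq_sym yx enorm_ge0.
have /inf_lt : dist_to V (y - x) < s' * enorm (y - x).
  by apply: con => //; rewrite yx0.
case=> [|_ [v /= Vv <-] vlt].
  by exists (enorm (y - x - 0)), 0 => //=; exact: mem0v.
have -> : (y - x) *m Q = (y - x - v) *m Q + v *m Q by rewrite -mulmxDl subrK.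
rewrite tail_mxD (@tail_mx_eq0 _ _ _ _ _ (v *m Q)) ?addr0; last first.
  by move=> j; exact: VQ.
by rewrite (le_trans (enorm_tail_le _ _))// enorm_orthogonal// ltW.
Qed.

(** * Countable decomposition *)

Lemma rat_mx_approx (R : realType) p q (M : 'M[R]_(p, q)) (e : R) : 0 < e ->
  exists N : 'M[rat]_(p, q), forall i j, `|M i j - ratr (N i j)| < e.
Proof.
move=> e0.
have /choice [f fP] : forall ij : 'I_p * 'I_q,
    exists a : rat, `|M ij.1 ij.2 - ratr a| < e.
  move=> [i j] /=.
  have [a] := @rat_in_itvoo R (M i j - e) (M i j + e) ltac:(lra).
  rewrite in_itv/= => /andP[a1 a2]; exists a.
  by rewrite ltr_norml; apply/andP; split; lra.
by exists (\matrix_(i, j) f (i, j)) => i j; rewrite mxE; exact: fP (i, j).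
Qed.

Lemma bounded_set_entries (R : realType) d (S : set 'rV[R]_d) (c : 'rV[R]_d) r :
  (forall x i, S x -> `|x ord0 i - c ord0 i| < r) -> bounded_set S.
Proof.
move=> Sr; exists (`|c| + `|r|); split; first exact: num_real.
move=> M /ltW cM x Sx; apply: le_trans cM.
rewrite -[x](subrK c) addrC (le_trans (ler_normD _ _))// lerD2l.
rewrite [leLHS]mx_normrE; apply/bigmax_leP; split => //= -[i j] _ /=.
by rewrite ord1 !mxE (le_trans (ltW (Sr x j Sx)))// ler_norm.
Qed.

(** A piece collects the points of [S] with comparable scale, nearby position
    and nearby coordinate change, the latter two up to rational approximation;
    then chords between two points of a piece are controlled in a single
    coordinate system, at the expense of increasing [t] to [t']. *)
Lemma countable_graph_cover (R : realType) d m (e : (m + (d - m))%N = d)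
    (S : set 'rV[R]_d) (t t' : R) : 0 <= t -> t < t' -> t' < 1 ->
  (forall x, S x -> exists (Q : 'M[R]_d) (r : R),
    [/\ Q *m Q^T = 1%:M, 0 < r & flat_at e S r t Q x]) ->
  exists Gamma : nat -> set 'rV[R]_d,
    (forall j, lipschitz_graph m (Gamma j) /\ bounded_set (Gamma j)) /\
    S `<=` \bigcup_j Gamma j.
Proof.
move=> t0 tt' t'1 Sflat.
have t'0 : 0 <= t' by rewrite ltW// (le_lt_trans t0).
have d0 : 0 <= d%:R :> R by [].
(* the denominators exceed the dimensional factors of [enorm_mulmx_le] and
   [enorm_le_entries], and remain positive for [d = 0] *)
pose eps : R := (t' - t) / (d%:R * d%:R * 2 + 1).
have den0 : 0 < d%:R * d%:R * 2 + 1 :> R by rewrite ltr_wpDl// !mulr_ge0.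
have eps0 : 0 < eps by rewrite divr_gt0 ?subr_gt0.
have epsE : d%:R * (d%:R * (eps + eps)) <= t' - t.
  have -> : d%:R * (d%:R * (eps + eps)) = d%:R * d%:R * 2 * (t' - t) / (d%:R * d%:R * 2 + 1).
    by rewrite /eps; field; rewrite gt_eqF.
  rewrite ler_pdivrMr// mulrC ler_wpM2l ?subr_ge0 1?ltW//.
  by rewrite -subr_gt0 addrAC subrr add0r.
pose sc (k : nat) : R := k.+1%:R^-1.
have sc0 k : 0 < sc k by rewrite invr_gt0.
pose del k : R := sc k / (d%:R * 2 + 1).
have den1 : 0 < d%:R * 2 + 1 :> R by rewrite ltr_wpDl// mulr_ge0.
have del0 k : 0 < del k by rewrite divr_gt0.
have delE k : d%:R * (del k + del k) < sc k.
  have -> : d%:R * (del k + del k) = d%:R * 2 * sc k / (d%:R * 2 + 1).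
    by rewrite /del; field; rewrite gt_eqF.
  by rewrite ltr_pdivrMr// mulrC ltr_pM2l// ltrDl.
pose compat (N : 'M[rat]_d) (k : nat) (x : 'rV[R]_d) (Q : 'M[R]_d) :=
  [/\ Q *m Q^T = 1%:M, forall i j, `|Q i j - ratr (N i j)| < eps &
      flat_at e S (sc k) t Q x].
pose piece (N : 'M[rat]_d) (c : 'rV[rat]_d) (k : nat) : set 'rV[R]_d :=
  [set x | [/\ S x, forall j, `|x ord0 j - ratr (c ord0 j)| < del k &
               exists Q, compat N k x Q]].
have empty_graph : lipschitz_graph m (set0 : set 'rV[R]_d).
  by apply: (@lipschitz_graph_of_chords _ _ _ e _ 1%:M t') => //;
    rewrite trmx1 mulmx1.
have piece_bounded N c k : bounded_set (piece N c k).
  apply: (@bounded_set_entries _ _ _ (map_mx ratr c) (del k)) => x j [_ xc _].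
  by rewrite mxE.
have piece_graph N c k : lipschitz_graph m (piece N c k).
  have [->|/set0P[x0 [_ _ [Q0 [QQ0 Q0N _]]]]] := eqVneq (piece N c k) set0.
    exact: empty_graph.
  apply: (lipschitz_graph_of_chords QQ0 t'0 t'1) => x y [Sx xc _] [Sy yc [Q [QQ QN yQ]]].
  have xy : enorm (x - y) < sc k.
    apply: le_lt_trans (delE k); apply: enorm_le_entries => j.
    rewrite !mxE -(subrK (ratr (c ord0 j)) (x ord0 j)) -addrA.
    rewrite (le_trans (ler_normD _ _))// lerD ?(ltW (xc j))//.
    by rewrite distrC (ltW (yc j)).
  have -> : (x - y) *m Q0 = (x - y) *m Q + (x - y) *m (Q0 - Q).
    by rewrite -mulmxDr [Q + _]addrC subrK.
  rewrite tail_mxD (le_trans (ler_enormD _ _))//.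
  rewrite (_ : t' = t + (t' - t)); last by rewrite addrC subrK.
  rewrite mulrDl lerD//; first exact: yQ.
  apply: le_trans (enorm_tail_le _ _) _.
  apply: le_trans (_ : _ <= d%:R * (d%:R * (eps + eps)) * enorm (x - y)) _.
    apply: enorm_mulmx_le => i j.
    rewrite !mxE -(subrK (ratr (N i j)) (Q0 i j)) -addrA.
    rewrite (le_trans (ler_normD _ _))// lerD ?(ltW (Q0N _ _))//.
    by rewrite distrC (ltW (QN _ _)).
  by rewrite ler_wpM2r// enorm_ge0.
exists (fun j => if unpickle j is Some (N, c, k) then piece N c k else set0).
split => [j|x Sx].
  case: unpickle => [[[N c] k]|]; first by [].
  split; first exact: empty_graph.
  exact: (@bounded_set_entries _ _ _ 0 0).
have [Q [r [QQ r0 Qx]]] := Sflat x Sx.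
have [N QN] := rat_mx_approx Q eps0.
have [k kr] : exists k, sc k < r.
  have [k _ /(_ k (leqnn k))] := near_infty_natSinv_lt (PosNum r0).
  by exists k.
have [c xc] := rat_mx_approx x (del0 k).
exists (pickle (N, c, k)) => //=; rewrite pickleK; split => //.
exists Q; split => // y Sy yx; apply: Qx => //; exact: lt_trans kr.
Qed.

Lemma rectifiable_of_graph_cover (R : realType) d m (S : set 'rV[R]_d)
    (Gamma : nat -> set 'rV[R]_d) : (0 < m)%N ->
  (forall j, lipschitz_graph m (Gamma j)) -> S `<=` \bigcup_j Gamma j ->
  rectifiable m S.
Proof.
move=> m0 graph cover.
have /choice [Df DfP] : forall j, exists Df : set 'rV[R]_m * ('rV[R]_m -> 'rV[R]_d),
    elipschitz Df.1 Df.2 /\ Gamma j = Df.2 @` Df.1.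
  by move=> j; have [D [f Df]] := lipschitz_graph_param (graph j); exists (D, f).
exists (fst \o Df), (snd \o Df); split; first by move=> j; exact: (DfP j).1.
rewrite (_ : _ `\` _ = set0) ?hausdorff0//.
rewrite -subset0 => x [/cover [j _ xj]]; apply; exists j => //.
by move: xj; rewrite (DfP j).2.
Qed.

Unset Implicit Arguments.

Theorem theorem1p1 (R : realType) (n m : nat) (hn : (1 <= n)%N)
    (hm : (1 <= m <= n)%N) (E : set 'rV[R]_n.+1) (hE : closed E)
    (s : R) (hs : 0 < s < 1 / 3) :
  (exists Gamma : nat -> set 'rV[R]_n.+1,
    (forall j, lipschitz_graph m (Gamma j) /\ bounded_set (Gamma j)) /\
    tangent_points m s E `<=` \bigcup_j Gamma j) /\
  rectifiable m (tangent_points m s E).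

Proof.
have [m0 mn] := andP hm; have [s0 s3] := andP hs.
have e : (m + (n.+1 - m))%N = n.+1 by rewrite subnKC// leqW.
have [Gamma [GammaP cover]] : exists Gamma : nat -> set 'rV[R]_n.+1,
    (forall j, lipschitz_graph m (Gamma j) /\ bounded_set (Gamma j)) /\
    tangent_points m s E `<=` \bigcup_j Gamma j.
  (* any two apertures between [s] and [1] would do *)
  apply: (@countable_graph_cover _ _ _ e _ (1 / 2) (3 / 4)); [lra..|].
  move=> x Tx.
  have [||Q [r [QQ r0 flat]]] := tangent_flat e s0 _ _ Tx (s' := 1 / 2); [lra..|].
  by exists Q, r; split => // y [Ey _ _]; exact: flat.
split; first by exists Gamma.
by apply: rectifiable_of_graph_cover cover => // j; have [] := GammaP j.
Qed.
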